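(* Let $H=H_{b,c,m}$ be subcritical and let $s$ be a non-negative superharmonic function on $X$. Then \[ Hs(x)\le \inf_{y\in X}\frac{s(y)}{G(y,x)}=\frac{s(x)}{G(x,x)},\qquad x\in X. \] Moreover, there is equality in the inequality at a vertex $x\in X$ if and only if either $s$ is a strictly positive multiple of $G1_o=G(\cdot,o)$ for some $o\in X$ and $x=o$, or $s=0$.
   Context: Setting: $X$ is an infinite set with the discrete topology; $b\colon X\times X\to[0,\infty)$ is symmetric, vanishes on the diagonal, and satisfies $\deg(x)=\sum_{y\in X}b(x,y)<\infty$ for all $x\in X$ (a graph over $X$). $X$ is connected with respect to $b$: any $x,y\in X$ are joined by a path $x=x_0,\dots,x_n=y$ in $X$ with $b(x_{i-1},x_i)>0$ for all $i$. Further, $c\colon X\to\mathbb{R}$ is an arbitrary function and $m\colon X\to(0,\infty)$. $\mathcal{C}(X)$ is the space of real-valued functions on $X$, and $\mathcal{C}_c(X)$ the subspace of finitely supported functions. For $K\subseteq X$, $\mathcal{C}(K)$ is viewed as a subspace of $\mathcal{C}(X)$ via extension by zero. Let $\mathcal{F}=\{f\in\mathcal{C}(X) : \sum_{y\in X}b(x,y)|f(y)|<\infty \text{ for all } x\in X\}$. The Schrödinger operator $H=H_{b,c,m}$ acts on $\mathcal{F}$ by \[ Hf(x)=\frac1{m(x)}\sum_{y\in X}b(x,y)\bigl(f(x)-f(y)\bigr)+\frac{c(x)}{m(x)}f(x),\qquad x\in X. \] A function $u\in\mathcal{F}$ is superharmonic if $Hu\ge0$ on $X$. $H$ is non-negative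 on $\mathcal{C}_c(X)$ if $\sum_{x\in X}(H\varphi)(x)\varphi(x)m(x)\ge0$ for all $\varphi\in\mathcal{C}_c(X)$. Green's function: suppose $H$ is non-negative on $\mathcal{C}_c(X)$. For finite $K\subseteq X$, the restriction $H^K$ of $H$ to $\mathcal{C}(K)$ (i.e. $H^K\varphi=(H\varphi)|_K$) is invertible. For an increasing exhaustion $(K_n)$ of $X$ by finite sets, let $G(x,y)=\lim_{n\to\infty}(H^{K_n})^{-1}1_y(x)\in[0,\infty]$, where $1_y$ is the characteristic function of $\{y\}$; this is independent of the exhaustion, and $G$ is strictly positive. $H$ is called subcritical if it is non-negative on $\mathcal{C}_c(X)$ and $G(x,y)<\infty$ for some (equivalently, all) $x,y\in X$. For $o\in X$, $G1_o$ denotes the function $x\mapsto G(x,o)$. *)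

(* Defs.v *)
From mathcomp Require Import all_boot all_order all_algebra.
From mathcomp Require Import all_classical all_reals all_analysis.

Set Implicit Arguments.
Unset Strict Implicit.
Unset Printing Implicit Defensive.

Import Order.TTheory GRing.Theory Num.Theory.
Import numFieldNormedType.Exports.
Local Open Scope classical_set_scope.
Local Open Scope ring_scope.

(* The sum of an absolutely summable family of reals over an arbitrary index
   set, as the difference of the sums of its positive and negative parts; it
   is only meaningful for absolutely summable families, which is what
   membership in [dom_F] (or finite support) guarantees below.  *)
Definition rsum (R : realType) (X : choiceType) (f : X -> R) : R :=
  fine (\esum_(y in [set: X]) ((f^\+)%R y)%:E
        - \esum_(y in [set: X]) ((f^\-)%R y)%:E)%E.

Record is_graph (R : realType) (X : choiceType) (b : X -> X -> R) : Prop := {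
  graph_ge0 : forall x y, 0 <= b x y;
  graph_sym : forall x y, b x y = b y x;
  graph_diag : forall x, b x x = 0;
  graph_deg : forall x, (\esum_(y in [set: X]) (b x y)%:E < +oo)%E }.

Definition graph_connected (R : realType) (X : choiceType) (b : X -> X -> R)
    : Prop :=
  forall x y, exists2 p : seq X, path (fun u v => 0 < b u v) x p & last x p = y.

Definition dom_F (R : realType) (X : choiceType) (b : X -> X -> R)
    : set (X -> R) :=
  [set f | forall x, (\esum_(y in [set: X]) (b x y * `|f y|)%:E < +oo)%E].

Definition schrodinger (R : realType) (X : choiceType) (b : X -> X -> R)
    (c m : X -> R) (f : X -> R) : X -> R :=
  fun x => (m x)^-1 * rsum (fun y => b x y * (f x - f y)) + c x / m x * f x.

Definition superharmonic (R : realType) (X : choiceType) (b : X -> X -> R)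
    (c m : X -> R) (u : X -> R) : Prop :=
  dom_F b u /\ forall x, 0 <= schrodinger b c m u x.

Definition fin_supp (R : realType) (X : choiceType) : set (X -> R) :=
  [set f | finite_set [set x | f x != 0]].

Definition nonneg_on_Cc (R : realType) (X : choiceType) (b : X -> X -> R)
    (c m : X -> R) : Prop :=
  forall phi : X -> R, fin_supp phi ->
    0 <= rsum (fun x => schrodinger b c m phi x * phi x * m x).

(* C(K) inside C(X), via extension by zero.  *)
Definition funs_on (R : realType) (X : choiceType) (K : set X)
    : set (X -> R) :=
  [set f | forall x, ~ K x -> f x = 0].

(* H^K on C(K): phi |-> (H phi)|_K, the restriction being extended by zero.  *)
Definition schrodinger_on (R : realType) (X : choiceType) (b : X -> X -> R)
    (c m : X -> R) (K : set X) (phi : X -> R) : X -> R :=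
  patch (fun=> 0) K (schrodinger b c m phi).

(* (H^K)^-1, the inverse of H^K : C(K) -> C(K).  The default value 0 is only
   taken outside the image of H^K.  *)
Definition schrodinger_on_inv (R : realType) (X : choiceType)
    (b : X -> X -> R) (c m : X -> R) (K : set X) : (X -> R) -> (X -> R) :=
  'pinv_(fun=> cst 0) (@funs_on R X K) (schrodinger_on b c m K).

Record exhaustion (X : choiceType) (K : nat -> set X) : Prop := {
  exhaustion_fin : forall n, finite_set (K n);
  exhaustion_homo : {homo K : i j / (i <= j)%N >-> i `<=` j};
  exhaustion_cover : \bigcup_n K n = [set: X] }.

(* The limit does not depend on the exhaustion K, which is kept as a parameter.
   Terms with y not in K n, where (H^(K n))^-1 1_y does not make sense, are
   finitely many and do not affect the limit.  *)
Definition green (R : realType) (X : choiceType) (b : X -> X -> R)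
    (c m : X -> R) (K : nat -> set X) (x y : X) : \bar R :=
  limn (fun n => (schrodinger_on_inv b c m (K n) (\1_[set y]) x)%:E).

Definition subcritical (R : realType) (X : choiceType) (b : X -> X -> R)
    (c m : X -> R) (K : nat -> set X) : Prop :=
  nonneg_on_Cc b c m /\ exists x y, (green b c m K x y < +oo)%E.

(* Main.v *)
(* Everything rests on comparison: if [w] is nonnegative off a finite set and
   [H w >= 0] on it, then [w >= 0]; testing [H w] against the negative part of
   [w] reduces this to the definiteness of the energy form on finite sets,
   which follows from nonnegativity because a null vector that vanishes
   somewhere vanishes at all neighbours, hence everywhere.  With [g_n] the Green
   function of [K_n] at [x], comparison applied to [s - H s(x) g_n] and to
   [g_n(x) s - s(x) g_n] gives, as [n] grows, [H s(x) G(., x) <= s] and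
   [s(x) G(., x) <= G(x, x) s].  In the equality case [s - H s(x) G(., x)] is
   nonnegative, superharmonic and vanishes at [x], hence vanishes identically. *)
Require Import Defs.
From mathcomp Require Import all_boot all_order all_algebra finmap.
From mathcomp Require Import all_classical all_reals all_analysis.
From mathcomp Require Import ring lra.

Set Implicit Arguments.
Unset Strict Implicit.
Unset Printing Implicit Defensive.

Import Order.TTheory GRing.Theory Num.Theory.
Import numFieldNormedType.Exports.
Local Open Scope classical_set_scope.
Local Open Scope ring_scope.

(** * The energy form on finite vertex sets *)

Section FiniteForm.
Context (R : realType) (X : choiceType) (b : X -> X -> R) (D : X -> R).
Implicit Types (F : {fset X}) (f g u : X -> R) (x y z : X).

(** For [D] the degree plus [c] and [f] supported in [F], this is [m x * H f x]. Keeping [D]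
    abstract leaves pure finite linear algebra. *)
Definition dirichlet F f x := D x * f x - \sum_(y <- F) b x y * f y.

Definition energy F f g := \sum_(x <- F) dirichlet F f x * g x.

Lemma dirichletD F f g x :
  dirichlet F (fun y => f y + g y) x = dirichlet F f x + dirichlet F g x.
Proof.
by rewrite /dirichlet; under eq_bigr do rewrite mulrDr; rewrite big_split/=; ring.
Qed.

Lemma dirichletZ F k f x :
  dirichlet F (fun y => k * f y) x = k * dirichlet F f x.
Proof.
rewrite /dirichlet; under eq_bigr do rewrite mulrCA.
by rewrite -mulr_sumr; ring.
Qed.

Lemma energyDl F f1 f2 g :
  energy F (fun y => f1 y + f2 y) g = energy F f1 g + energy F f2 g.
Proof. by rewrite -big_split; apply: eq_bigr => x _; rewrite dirichletD mulrDl. Qed.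

Lemma energyDr F f g1 g2 :
  energy F f (fun y => g1 y + g2 y) = energy F f g1 + energy F f g2.
Proof. by rewrite -big_split; apply: eq_bigr => x _; rewrite mulrDr. Qed.

Lemma energyZl F k f g : energy F (fun y => k * f y) g = k * energy F f g.
Proof. by rewrite mulr_sumr; apply: eq_bigr => x _; rewrite dirichletZ mulrA. Qed.

Lemma energyZr F k f g : energy F f (fun y => k * g y) = k * energy F f g.
Proof. by rewrite mulr_sumr; apply: eq_bigr => x _; rewrite mulrCA. Qed.

Lemma eq_energy F f f' g g' : {in F, f =1 f'} -> {in F, g =1 g'} ->
  energy F f g = energy F f' g'.
Proof.
move=> ff gg; rewrite /energy !big_seq; apply: eq_bigr => x xF.
rewrite /dirichlet ff// gg//; congr ((_ - _) * _).
by rewrite !big_seq; apply: eq_bigr => y yF; rewrite ff.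
Qed.

Lemma energy_incl F F' f g : (F `<=` F')%fset ->
    {in F', forall x, x \notin F -> f x = 0} ->
    {in F', forall x, x \notin F -> g x = 0} ->
  energy F' f g = energy F f g.
Proof.
move=> sFF f0 g0; rewrite /energy.
rewrite -(big_fset_incl _ sFF) => [|x xF' xF]; last by rewrite g0// mulr0.
apply: eq_bigr => x _; congr ((_ - _) * _).
by rewrite -(big_fset_incl _ sFF)// => y yF' yF; rewrite f0// mulr0.
Qed.

Hypothesis b_sym : forall x y, b x y = b y x.

Lemma energy_sym F f g : energy F f g = energy F g f.
Proof.
rewrite /energy /dirichlet; under eq_bigr do rewrite mulrBl mulr_suml.
under [RHS]eq_bigr do rewrite mulrBl mulr_suml.
rewrite !sumrB; congr (_ - _); first by apply: eq_bigr => x _; ring.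
rewrite exchange_big/=; apply: eq_bigr => x _; apply: eq_bigr => y _.
by rewrite b_sym; ring.
Qed.

Hypothesis b_ge0 : forall x y, 0 <= b x y.
Hypothesis energy_ge0 : forall F f, 0 <= energy F f f.

(* A nonnegative null vector of a nonnegative form lies in its kernel; evaluating
   the kernel equation at a zero of [f] kills the neighbouring values. *)
Lemma null_energy_neighbour F f z y : (forall x, 0 <= f x) ->
    (forall x, x \notin F -> f x = 0) -> energy F f f = 0 ->
  f z = 0 -> 0 < b z y -> f y = 0.
Proof.
move=> f0 fF Qf fz bzy; have [yF|/fF//] := boolP (y \in F).
pose F' := (z |` F)%fset.
have sFF : (F `<=` F')%fset by apply: fsubsetUr.
have zF' : z \in F' by rewrite !inE eqxx.
have Qf' : energy F' f f = 0 by rewrite (energy_incl sFF) => // x _ /fF.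
pose e x : R := (x == z)%:R.
have Qe g : energy F' g e = dirichlet F' g z.
  rewrite /energy (big_fsetD1 z)//= /e eqxx mulr1 big_seq big1 ?addr0// => x.
  by rewrite !inE => /andP[/negPf -> _]; rewrite mulr0.
set S := \sum_(x <- F') b z x * f x.
have Qfe : energy F' f e = - S by rewrite Qe /dirichlet fz mulr0 add0r.
have S0 : 0 <= S by apply: sumr_ge0 => x _; apply: mulr_ge0.
set d := energy F' e e.
have d0 : 0 <= d by apply: energy_ge0.
(* The energy of [f + t * e] is a quadratic in [t] without constant term, so its linear coefficient
   must vanish. *)
have Qt t : 0 <= t ^+ 2 * d - 2 * t * S.
  have := energy_ge0 F' (fun x => f x + t * e x).
  rewrite energyDl !energyDr energyZl !energyZr energyZl Qf' (energy_sym _ e f) Qfe -/d.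
  by congr (0 <= _); ring.
have : S = 0.
  have d1 : 0 < d + 1 by lra.
  (* The minimiser would be [S / d], but [d] may be [0]; with [d + 1] the value is still negative
     unless [S = 0]. *)
  have := Qt (S / (d + 1)).
  have -> : (S / (d + 1)) ^+ 2 * d - 2 * (S / (d + 1)) * S =
     - (S ^+ 2 * ((d + 2) / (d + 1) ^+ 2)) by field; rewrite gt_eqF.
  rewrite oppr_ge0 pmulr_lle0; last by apply: divr_gt0; [lra|apply: exprn_gt0].
  by move=> S2; apply/eqP; rewrite -sqrf_eq0 eq_le S2 sqr_ge0.
move=> /eqP; rewrite psumr_eq0 => [|x _]; last exact: mulr_ge0.
move=> /allP /(_ y); rewrite !inE yF orbT => /(_ isT).
by rewrite mulf_eq0 gt_eqF//= => /eqP.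
Qed.

Hypothesis b_connected : graph_connected b.
Hypothesis X_infinite : infinite_set [set: X].

Lemma connected_zero f : (forall z y, f z = 0 -> 0 < b z y -> f y = 0) ->
  forall z, f z = 0 -> forall y, f y = 0.
Proof.
move=> fb z fz y; have [p] := b_connected z y.
elim: p z fz => [|x p IHp] z fz /=; first by move=> _ <-.
by move=> /andP[bzx]; apply: IHp; apply: fb bzx.
Qed.

Lemma energy_definite F f : {in F, forall x, 0 <= f x} -> energy F f f <= 0 ->
  {in F, forall x, f x = 0}.
Proof.
move=> f0 Qf x xF; pose g x := if x \in F then f x else 0.
have gF : {in F, g =1 f} by move=> y yF; rewrite /g yF.
rewrite -gF//.
(* Infinitude of [X] supplies a zero of the extension [g], from which vanishing spreads. *)
have [z zF] : exists z, z \notin F.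
  apply: contrapT => nF; apply: X_infinite; apply/finite_fsetP; exists F.
  apply/seteqP; split => // z _ /=; apply: contrapT => /negP zF.
  by apply: nF; exists z.
apply: (@connected_zero g _ z) => [z' y|]; last by rewrite /g (negPf zF).
apply: (@null_energy_neighbour F) => [y'|y'|].
- by rewrite /g; case: ifPn => // /f0.
- by rewrite /g => /negPf ->.
- by apply/eqP; rewrite eq_le energy_ge0 andbT (@eq_energy _ _ f _ f).
Qed.

(** Let [n] be the negative part of [u] and [p = u + n]. Since [p * n = 0] and [b >= 0], only
    nonpositive off-diagonal terms remain in the energy of [p] against [n], while that of [u]
    against [n] is nonnegative. So [n] has energy at most [0], and definiteness applies. *)
Lemma dirichlet_min_principle F u : {in F, forall x, 0 <= dirichlet F u x} ->
  {in F, forall x, 0 <= u x}.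
Proof.
move=> Lu; pose n x := Num.max (- u x) 0; pose p x := Num.max (u x) 0.
have n0 x : 0 <= n x by rewrite /n le_max lexx orbT.
have p0 x : 0 <= p x by rewrite /p le_max lexx orbT.
have pn x : p x * n x = 0.
  by rewrite /p /n /Num.max; case: ltP => ?; case: ltP => ?; rewrite ?mulr0 ?mul0r//; nra.
have pE x : p x = u x + n x.
  by rewrite /p /n /Num.max; case: ltP => ?; case: ltP => ?; lra.
have Qun : 0 <= energy F u n.
  by rewrite /energy big_seq; apply: sumr_ge0 => x xF; rewrite mulr_ge0// Lu.
have Qpn : energy F p n <= 0.
  apply: sumr_le0 => x _.
  rewrite /dirichlet mulrBl -mulrA pn mulr0 sub0r oppr_le0.
  by apply: mulr_ge0 => //; apply: sumr_ge0 => y _; apply: mulr_ge0.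
have Qnn : energy F n n <= 0.
  move: Qpn; rewrite (@eq_energy F p (fun x => u x + n x) n n)// energyDl; lra.
move=> x xF; have := @energy_definite F n (fun x _ => n0 x) Qnn x xF.
by rewrite /n /Num.max; case: ltP => ?; lra.
Qed.

(** The system is square, so injectivity suffices; the minimum principle, applied to a kernel vector
    and to its negative, shows that it vanishes. *)
Lemma dirichlet_surj F g : exists2 u, (forall x, x \notin F -> u x = 0) &
  {in F, forall x, dirichlet F u x = g x}.
Proof.
pose ext (v : 'rV[R]_#|{: F}|) x : R :=
  if insub x is Some i then v 0 (enum_rank (i : F)) else 0.
(* Row vectors multiply from the left: the row index [i] is the variable and the column index [j]
   the equation. *)
pose A := (\matrix_(i < #|{: F}|, j < #|{: F}|)
   (D (val (enum_val j)) * (i == j)%:R - b (val (enum_val j)) (val (enum_val i)))).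
have AE v (k : F) : (v *m A) 0 (enum_rank k) = dirichlet F (ext v) (val k).
  rewrite /dirichlet mxE.
  have extk (i : F) : ext v (val i) = v 0 (enum_rank i) by rewrite /ext valK.
  under eq_bigr => i _ do rewrite mxE enum_rankK mulrBr.
  rewrite sumrB; congr (_ - _).
    rewrite (bigD1 (enum_rank k))//= eqxx mulr1 big1 ?addr0 => [|i ik].
      by rewrite extk mulrC.
    by rewrite (negPf ik) !mulr0.
  rewrite big_seq_fsetE/=; rewrite (reindex (fun i : 'I_#|{: F}| => enum_val i))/=.
    by apply: eq_bigr => i _; rewrite extk enum_valK mulrC.
  by apply: onW_bij; exists enum_rank; [exact: enum_valK|exact: enum_rankK].
have Aunit : A \in unitmx.
  rewrite -row_free_unit -kermx_eq0; apply/eqP/row_matrixP => i; rewrite row0.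
  have : row i (kermx A) *m A = 0 by rewrite -row_mul mulmx_ker row0.
  move: (row i _) => v vA; apply/rowP => j; rewrite [RHS]mxE.
  have L0 : {in F, forall x, dirichlet F (ext v) x = 0}.
    by move=> x xF; rewrite -(AE v [` xF]%fset) vA mxE.
  have extj : ext v (val (enum_val j)) = v 0 j by rewrite /ext valK enum_valK.
  have jF : val (enum_val j) \in F by exact: valP.
  have v0 : 0 <= ext v (val (enum_val j)).
    by apply: (@dirichlet_min_principle F) jF => x /L0 ->.
  have v1 : 0 <= -1 * ext v (val (enum_val j)).
    apply: (@dirichlet_min_principle F (fun x => -1 * ext v x)) jF => x xF.
    by rewrite dirichletZ L0// mulr0.
  by rewrite -extj; lra.
exists (ext (\row_j g (val (enum_val j)) *m invmx A)).
  by move=> x xF; rewrite /ext insubN.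
move=> x xF; rewrite -(AE _ [` xF]%fset) mulmxKV// mxE enum_rankK//.
Qed.

End FiniteForm.

(** * Absolutely summable real families over arbitrary index sets *)

Section Rsum.
Context (R : realType) (X : choiceType).
Implicit Types (f g : X -> R) (F : {fset X}).

Definition abs_summable f := (\esum_(y in [set: X]) `|f y|%:E < +oo)%E.

Lemma ge0_summableE f : (forall x, 0 <= f x) ->
  abs_summable f = (\esum_(y in [set: X]) (f y)%:E < +oo)%E.
Proof.
by move=> f0; congr (_ < _)%E; apply: eq_esum => x _; rewrite ger0_norm.
Qed.

Lemma fset_le_esum f F : (forall x, 0 <= f x) ->
  ((\sum_(x <- F) f x)%:E <= \esum_(y in [set: X]) (f y)%:E)%E.
Proof.
move=> f0; apply: esum_ge; exists [set` F]; first by split; [exact: finite_fset|].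
by rewrite fsbig_finite ?finite_fset//= set_fsetK -sumEFin.
Qed.

Lemma esum_le_fset f M : (forall F, \sum_(x <- F) f x <= M) ->
  (\esum_(y in [set: X]) (f y)%:E <= M%:E)%E.
Proof.
move=> fM; apply: ge_ereal_sup => _ [A [finA _] <-].
by rewrite fsbig_finite//= sumEFin lee_fin.
Qed.

Lemma abs_summable_le f M : (forall F, \sum_(x <- F) `|f x| <= M) -> abs_summable f.
Proof. by move=> /esum_le_fset fM; apply: le_lt_trans fM _; rewrite ltry. Qed.

Lemma ge0_rsumE f : (forall x, 0 <= f x) ->
  rsum f = fine (\esum_(y in [set: X]) (f y)%:E).
Proof.
move=> f0; rewrite /rsum [X in (_ - X)%E]esum1 ?sube0.
  by congr fine; apply: eq_esum => x _; congr EFin; apply/max_idPl.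
by move=> x _; congr EFin; apply/max_idPr; rewrite oppr_le0.
Qed.

(** Together with [rsum_le_fset], this reduces estimates of nonnegative sums to finite partial
    sums. *)
Lemma fset_le_rsum f F : (forall x, 0 <= f x) -> abs_summable f ->
  \sum_(x <- F) f x <= rsum f.
Proof.
move=> f0 sf; rewrite ge0_rsumE// -lee_fin fineK ?fset_le_esum//.
by rewrite ge0_fin_numE -?ge0_summableE// esum_ge0// => x _; rewrite lee_fin.
Qed.

Lemma rsum_le_fset f M : (forall x, 0 <= f x) ->
  (forall F, \sum_(x <- F) f x <= M) -> rsum f <= M.
Proof.
move=> f0 fM; have fM' := esum_le_fset fM.
rewrite ge0_rsumE// -lee_fin fineK//.
rewrite ge0_fin_numE ?(le_lt_trans fM') ?ltry//.
by rewrite esum_ge0// => x _; rewrite lee_fin.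
Qed.

Lemma abs_summable_dom f g : (forall x, `|f x| <= g x) -> abs_summable g -> abs_summable f.
Proof.
move=> fg; apply: le_lt_trans; apply: le_esum => x _; rewrite lee_fin.
exact: le_trans (fg x) (ler_norm _).
Qed.

Lemma abs_summableD f g : abs_summable f -> abs_summable g ->
  abs_summable (fun x => f x + g x).
Proof. exact: (@summableD _ _ _ (EFin \o f) (EFin \o g)). Qed.

(** The functions [f] and [g] need not be the positive and negative parts of their difference; this
    freedom is what makes [rsum] additive. *)
Lemma ge0_rsumB f g : (forall x, 0 <= f x) -> (forall x, 0 <= g x) ->
  abs_summable f -> abs_summable g -> rsum (fun x => f x - g x) = rsum f - rsum g.
Proof.
move=> f0 g0 sf sg.
rewrite [RHS](_ : _ = fine (\esum_(y in [set: X]) (f y)%:E - \esum_(y in [set: X]) (g y)%:E)).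
  rewrite -esumB//; [|by move=> x _; rewrite lee_fin..].
  by congr (fine (_ - _)); apply: eq_esum => x _; rewrite ?funeposE ?funenegE /= EFin_max.
by rewrite !ge0_rsumE// fineB// ge0_fin_numE -?ge0_summableE//;
  rewrite esum_ge0// => x _; rewrite lee_fin.
Qed.

Lemma ge0_rsumD f g : (forall x, 0 <= f x) -> (forall x, 0 <= g x) ->
  abs_summable f -> abs_summable g -> rsum (fun x => f x + g x) = rsum f + rsum g.
Proof.
move=> f0 g0 sf sg; rewrite !ge0_rsumE// => [|x]; last by rewrite addr_ge0.
rewrite -fineD; last 2 first.
- by rewrite ge0_fin_numE -?ge0_summableE// esum_ge0// => x _; rewrite lee_fin.
- by rewrite ge0_fin_numE -?ge0_summableE// esum_ge0// => x _; rewrite lee_fin.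
by rewrite -esumD// => x _; rewrite lee_fin.
Qed.

Lemma abs_summable_funrpos f : abs_summable f -> abs_summable f^\+%R.
Proof.
move=> sf; apply: (abs_summable_dom (g := fun x => `|f x|)).
  by move=> x; rewrite ger0_norm ?le_max ?lexx ?orbT// ge_max ler_norm normr_ge0.
by apply: le_lt_trans sf; apply: le_esum => x _; rewrite normr_id.
Qed.

Lemma abs_summableN f : abs_summable f -> abs_summable (fun x => - f x).
Proof.
by apply: le_lt_trans; apply: le_esum => x _; rewrite normrN.
Qed.

Lemma abs_summable_norm f : abs_summable f -> abs_summable (fun x => `|f x|).
Proof.
by apply: le_lt_trans; apply: le_esum => x _; rewrite normr_id.
Qed.

Lemma rsumD f g : abs_summable f -> abs_summable g ->
  rsum (fun x => f x + g x) = rsum f + rsum g.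
Proof.
move=> sf sg.
have pos h x : 0 <= (h^\+)%R x :> R by rewrite /funrpos le_max lexx orbT.
have neg h x : 0 <= (h^\-)%R x :> R by rewrite /funrneg le_max lexx orbT.
have spf := abs_summable_funrpos sf; have spg := abs_summable_funrpos sg.
have snf : abs_summable f^\-%R := abs_summable_funrpos (abs_summableN sf).
have sng : abs_summable g^\-%R := abs_summable_funrpos (abs_summableN sg).
have E h : h = (fun x => (h^\+)%R x - (h^\-)%R x) :> (X -> R).
  apply/funext => x; rewrite /funrpos /funrneg /Num.max.
  by case: ltP => ?; case: ltP => ?; lra.
rewrite [in RHS](E f) [in RHS](E g) !ge0_rsumB//.
rewrite [X in rsum X](_ : _ = (fun x => (f^\+ x + g^\+ x) - (f^\- x + g^\- x))%R); last first.
  by apply/funext => x; rewrite [in LHS](E f) [in LHS](E g) opprD addrACA.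
rewrite ge0_rsumB => [|x|x||]; rewrite ?addr_ge0 ?abs_summableD//.
by rewrite !ge0_rsumD// opprD addrACA.
Qed.

Lemma abs_summableZ k f : abs_summable f -> abs_summable (fun x => k * f x).
Proof.
move=> sf; apply: (@abs_summable_le _ (`|k| * rsum (fun x => `|f x|))) => F.
under eq_bigr do rewrite normrM; rewrite -mulr_sumr ler_wpM2l// fset_le_rsum//.
exact: abs_summable_norm.
Qed.

Lemma ge0_rsumZ k f : 0 <= k -> (forall x, 0 <= f x) -> abs_summable f ->
  rsum (fun x => k * f x) = k * rsum f.
Proof.
move=> k0 f0 sf; have kf0 x : 0 <= k * f x by rewrite mulr_ge0.
have skf := abs_summableZ k sf.
apply/eqP; rewrite eq_le; apply/andP; split.
  by apply: rsum_le_fset => // F; rewrite -mulr_sumr ler_wpM2l// fset_le_rsum.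
(* The reverse inequality divides by [k], so [k = 0] is treated apart, through the empty partial
   sum. *)
move: k0; rewrite [0 <= k]le_eqVlt => /orP[/eqP k0|k0].
  rewrite -[X in X * _]k0 mul0r; have := fset_le_rsum fset0 kf0 skf.
  by rewrite big_seq_fset0.
rewrite -ler_pdivlMl//; apply: rsum_le_fset => // F.
by rewrite ler_pdivlMl// mulr_sumr fset_le_rsum.
Qed.

Lemma rsumZ k f : abs_summable f -> rsum (fun x => k * f x) = k * rsum f.
Proof.
wlog k0 : k f / 0 <= k => [hk sf|sf].
  have [/hk|k0] := leP 0 k; first exact.
  rewrite [X in rsum X](_ : _ = (fun x => - k * (-1 * f x))).
    rewrite hk; [|lra|exact: abs_summableZ].
    suff : rsum f + rsum (fun x => -1 * f x) = 0 by move=> /eqP; rewrite addr_eq0 => /eqP ->; ring.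
    rewrite -rsumD//; last exact: abs_summableZ.
    have sf' := abs_summable_norm sf.
    (* Writing [0] as a sum of absolute values minus itself lets [ge0_rsumB] identify it with the
       sum of the zero function. *)
    rewrite -(subrr (rsum (fun x => `|f x|))) -ge0_rsumB//.
    by congr rsum; apply/funext => x; lra.
  by apply/funext => x; lra.
have pos x : 0 <= (f^\+)%R x by rewrite /funrpos le_max lexx orbT.
have neg x : 0 <= (f^\-)%R x by rewrite /funrneg le_max lexx orbT.
have sp := abs_summable_funrpos sf.
have sn : abs_summable f^\-%R := abs_summable_funrpos (abs_summableN sf).
have E : f = (fun x => (f^\+)%R x - (f^\-)%R x) :> (X -> R).
  apply/funext => x; rewrite /funrpos /funrneg /Num.max.
  by case: ltP => ?; case: ltP => ?; lra.
rewrite [X in _ = _ * rsum X]E ge0_rsumB// mulrBr -!ge0_rsumZ//.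
rewrite -ge0_rsumB => [|x|x||]; rewrite ?mulr_ge0 ?abs_summableZ//.
by congr rsum; apply/funext => x; rewrite [in LHS]E mulrBr.
Qed.

Lemma fsupp_abs_summable f F : (forall x, x \notin F -> f x = 0) -> abs_summable f.
Proof.
move=> fF; apply: (@abs_summable_le _ (\sum_(x <- F) `|f x|)) => F'.
rewrite [leRHS](big_fset_incl _ (fsubsetUl F F')) => [|x _ /fF ->]; last by rewrite normr0.
rewrite (big_fsetID _ (mem F')) /= (_ : [fset x in _ | x \in F']%fset = F').
  by rewrite lerDl sumr_ge0.
by apply/fsetP => x; rewrite !inE; case: (x \in F'); rewrite ?orbT ?andbF.
Qed.

Lemma rsum_fsupp f F : (forall x, x \notin F -> f x = 0) ->
  rsum f = \sum_(x <- F) f x.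
Proof.
have ge0_case g : (forall x, 0 <= g x) -> (forall x, x \notin F -> g x = 0) ->
    rsum g = \sum_(x <- F) g x.
  move=> g0 gF; apply/eqP; rewrite eq_le; apply/andP; split; last first.
    by apply: fset_le_rsum => //; exact: fsupp_abs_summable gF.
  apply: rsum_le_fset => // F'.
  rewrite [leRHS](big_fset_incl _ (fsubsetUl F F')) => [|x _ /gF ->//].
  rewrite [leRHS](big_fsetID _ (mem F')) /= (_ : [fset x in _ | x \in F']%fset = F').
    by rewrite lerDl sumr_ge0.
  by apply/fsetP => x; rewrite !inE; case: (x \in F'); rewrite ?orbT ?andbF.
move=> fF.
have pos x : 0 <= (f^\+)%R x by rewrite /funrpos le_max lexx orbT.
have neg x : 0 <= (f^\-)%R x by rewrite /funrneg le_max lexx orbT.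
have pF x : x \notin F -> (f^\+)%R x = 0 by move=> /fF fx; rewrite /funrpos fx maxxx.
have nF x : x \notin F -> (f^\-)%R x = 0.
  by move=> /fF fx; rewrite /funrneg fx oppr0 maxxx.
have E x : f x = (f^\+)%R x - (f^\-)%R x :> R.
  by rewrite /funrpos /funrneg /Num.max; case: ltP => ?; case: ltP => ?; lra.
rewrite [in LHS](funext E : f = _) ge0_rsumB//; last 2 first.
- exact: fsupp_abs_summable pF.
- exact: fsupp_abs_summable nF.
by rewrite !ge0_case// -sumrB; apply: eq_bigr => x _; rewrite -E.
Qed.

(** Subtracting from [f] its restriction to [F] leaves a nonnegative function, whose sum dominates
    the empty partial sum. The signs of [f] on [F] stay free, as comparison requires. *)
Lemma fset_le_rsum_off f F : (forall x, x \notin F -> 0 <= f x) ->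
  abs_summable f -> \sum_(x <- F) f x <= rsum f.
Proof.
move=> f0 sf; pose f1 x := if x \in F then f x else 0.
have f1F x : x \notin F -> f1 x = 0 by rewrite /f1 => /negPf ->.
have sf1 := fsupp_abs_summable f1F.
pose f2 x := f x + -1 * f1 x.
have f20 x : 0 <= f2 x.
  by rewrite /f2 /f1; case: ifPn => [_|/f0]; lra.
have := fset_le_rsum fset0 f20 (abs_summableD sf (abs_summableZ _ sf1)).
rewrite big_seq_fset0 rsumD ?rsumZ//; last exact: abs_summableZ.
rewrite (rsum_fsupp f1F) mulN1r subr_ge0; apply: le_trans.
by rewrite [leLHS]big_seq [leRHS]big_seq ler_sum// => x xF; rewrite /f1 xF.
Qed.

End Rsum.

(** * The Schrodinger operator: linearity, comparison, inversion on finite sets *)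

Section Schrodinger.
Context (R : realType) (X : choiceType) (b : X -> X -> R) (c m : X -> R).
Implicit Types (F : {fset X}) (f g u : X -> R) (x y z : X).
Hypotheses (b_graph : is_graph b) (m_gt0 : forall x, 0 < m x).

Local Notation H := (schrodinger b c m).

(** The diagonal entry of [m * H]. As [c] is arbitrary, its sign is not evident; see
    [diag_coef_gt0]. *)
Definition diag_coef x := rsum (b x) + c x.

Local Notation D := diag_coef.

Let b_ge0 x y : 0 <= b x y. Proof. exact: (graph_ge0 b_graph). Qed.
Let b_sym x y : b x y = b y x. Proof. exact: (graph_sym b_graph). Qed.

Lemma dom_FP f : dom_F b f <-> forall x, abs_summable (fun y => b x y * f y).
Proof.
suff E x : (\esum_(y in [set: X]) (b x y * `|f y|)%:E =
            \esum_(y in [set: X]) `|b x y * f y|%:E)%E.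
  by split=> df x; have := df x; rewrite /abs_summable E.
by apply: eq_esum => y _; rewrite normrM ger0_norm.
Qed.

Lemma abs_summable_deg x : abs_summable (b x).
Proof. by rewrite ge0_summableE//; exact: (graph_deg b_graph). Qed.

(** The sum may be split because the degree is finite and [f] lies in [dom_F]. *)
Lemma schrodingerE f x : dom_F b f ->
  m x * H f x = D x * f x - rsum (fun y => b x y * f y).
Proof.
move=> /dom_FP/(_ x) sf.
rewrite /schrodinger [X in rsum X](_ : _ = (fun y => f x * b x y + -1 * (b x y * f y))).
  have sb := abs_summable_deg x.
  rewrite rsumD ?rsumZ//; [|exact: abs_summableZ..].
  by rewrite /D; field; rewrite gt_eqF.
by apply/funext => y; ring.
Qed.

Lemma schrodinger_ge0 f x : dom_F b f ->
  (0 <= H f x) = (rsum (fun y => b x y * f y) <= D x * f x).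
Proof. by move=> df; rewrite -(pmulr_rge0 _ (m_gt0 x)) schrodingerE// subr_ge0. Qed.

Lemma dom_F_comb k l f g : dom_F b f -> dom_F b g ->
  dom_F b (fun y => k * f y - l * g y).
Proof.
move=> /dom_FP df /dom_FP dg; apply/dom_FP => x.
rewrite [X in abs_summable X](_ : _ =
  (fun y => k * (b x y * f y) + - l * (b x y * g y))); last by apply/funext => y; ring.
by apply: abs_summableD; apply: abs_summableZ.
Qed.

(** The shape [k * f - l * g] fits the differences used in comparison; taking [l = 0] gives
    scalings. *)
Lemma schrodinger_comb k l f g x : dom_F b f -> dom_F b g ->
  H (fun y => k * f y - l * g y) x = k * H f x - l * H g x.
Proof.
move=> df dg; apply: (mulfI (lt0r_neq0 (m_gt0 x))).
rewrite mulrBr !(mulrCA (m x)) !schrodingerE//; last exact: dom_F_comb.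
rewrite [X in rsum X](_ : _ =
  (fun y => k * (b x y * f y) + - l * (b x y * g y))); last by apply/funext => y; ring.
move: df dg => /dom_FP/(_ x) df /dom_FP/(_ x) dg.
rewrite rsumD ?rsumZ//; [|exact: abs_summableZ..].
by ring.
Qed.

Lemma fsupp_dom_F F f : (forall x, x \notin F -> f x = 0) -> dom_F b f.
Proof.
move=> fF; apply/dom_FP => x.
by apply: (@fsupp_abs_summable _ _ _ F) => y /fF ->; rewrite mulr0.
Qed.

Lemma fsupp_schrodingerE F f x : (forall x, x \notin F -> f x = 0) ->
  m x * H f x = dirichlet b D F f x.
Proof.
move=> fF; rewrite schrodingerE; last exact: fsupp_dom_F fF.
by rewrite (@rsum_fsupp _ _ _ F)// => y /fF ->; rewrite mulr0.
Qed.

Hypothesis H_nonneg : nonneg_on_Cc b c m.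

(** The form only sees the values on [F], so [f] may be cut off outside [F] and becomes an
    admissible test function. *)
Lemma energy_ge0 F f : 0 <= energy b D F f f.
Proof.
pose g x := if x \in F then f x else 0.
have gF x : x \notin F -> g x = 0 by rewrite /g => /negPf ->.
have gf : {in F, f =1 g} by move=> x xF; rewrite /g xF.
rewrite (eq_energy b D gf gf).
have /H_nonneg : fin_supp g.
  apply: (@sub_finite_set _ _ [set` F]); last exact: finite_fset.
  by move=> x /=; apply: contra_neqT => /gF.
rewrite (@rsum_fsupp _ _ _ F) => [|x /gF ->]; last by rewrite mulr0 mul0r.
congr (0 <= _); apply: eq_bigr => x _.
by rewrite -(fsupp_schrodingerE _ gF); ring.
Qed.

Hypothesis b_connected : graph_connected b.
Hypothesis X_infinite : infinite_set [set: X].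

(** Passing from [m x * H f x] to [dirichlet] drops the terms [b x y * f y] with [y] outside [F].
    These are nonnegative and enter with a minus sign, so [dirichlet] is at least as large and the
    minimum principle applies. *)
Lemma comparison F f : dom_F b f -> (forall x, x \notin F -> 0 <= f x) ->
  {in F, forall x, 0 <= H f x} -> forall x, 0 <= f x.
Proof.
move=> df f0 Hf x; have [|/f0//] := boolP (x \in F); move: x.
apply: (dirichlet_min_principle b_sym b_ge0 energy_ge0) => // x xF.
have := Hf _ xF; rewrite schrodinger_ge0// -subr_ge0 => /le_trans; apply.
rewrite lerD2l lerN2; apply: fset_le_rsum_off => [y /f0 fy|].
  exact: mulr_ge0.
by move/dom_FP: df; apply.
Qed.

(** At a zero, [H f >= 0] bounds a sum of nonnegative terms by [0]; hence [f] vanishes at all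
    neighbours, and connectedness does the rest. *)
Lemma superharmonic_zero f : (forall x, 0 <= f x) -> superharmonic b c m f ->
  forall z, f z = 0 -> forall y, f y = 0.
Proof.
move=> f0 [df Hf]; apply: (connected_zero b_connected) => z y fz bzy.
have := Hf z; rewrite schrodinger_ge0// fz mulr0.
have /dom_FP/(_ z) sf := df.
have /fset_le_rsum/(_ sf) bf0 : forall y, 0 <= b z y * f y by move=> y'; exact: mulr_ge0.
move=> /(le_trans (bf0 [fset y]%fset)); rewrite big_seq_fset1 pmulr_rle0// => fy.
by apply/eqP; rewrite eq_le fy f0.
Qed.

(** By [dirichlet_surj], [g] lies in the image, so the default value of the partial inverse does not
    intervene. *)
Lemma schrodinger_on_invP F g : (forall x, x \notin F -> g x = 0) ->
  let u := schrodinger_on_inv b c m [set` F] g in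
  (forall x, x \notin F -> u x = 0) /\ {in F, forall x, H u x = g x}.
Proof.
move=> gF u.
have [v vF vg] := dirichlet_surj b_sym b_ge0 energy_ge0 b_connected X_infinite F
  (fun x => m x * g x).
have gim : (schrodinger_on b c m [set` F] @` @funs_on R X [set` F]) g.
  exists v; first by move=> x /negP /vF.
  apply/funext => x; rewrite /schrodinger_on /patch mem_setE.
  case: ifPn => [xF|/gF ->//].
  by apply: (mulfI (lt0r_neq0 (m_gt0 x))); rewrite (fsupp_schrodingerE _ vF) vg.
have uF : funs_on [set` F] u.
  (* Surjectivity onto the singleton of [g] is enough to place [u] among the functions supported on
     [F]. *)
  have gsurj : set_surj (@funs_on R X [set` F]) [set g] (schrodinger_on b c m [set` F]).
    by move=> _ ->.
  by apply: (surjpinv_image_sub (dflt := fun=> cst 0) gsurj); exists g.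
split=> [x /negP|x xF]; first exact: uF.
have gE : schrodinger_on b c m [set` F] u = g by exact: (pinvK _ (mem_set gim)).
by rewrite -[in RHS]gE /schrodinger_on /patch mem_setE xF.
Qed.

(** * Green functions along an exhaustion and their limit *)

Section Green.
Context (K : nat -> set X).
Hypothesis K_exhaustion : exhaustion K.

Definition green_on n y := schrodinger_on_inv b c m (K n) (\1_[set y]).

Local Notation fK n := (fset_set (K n)).

Let KE n : K n = [set` fK n].
Proof. by rewrite fset_setK//; exact: (exhaustion_fin K_exhaustion). Qed.

Let inK n x : (x \in fK n) = (x \in K n).
Proof. by rewrite in_fset_set//; exact: (exhaustion_fin K_exhaustion). Qed.

Lemma near_exhaustion x : \forall n \near \oo, K n x.
Proof.
have [N _ KN] : (\bigcup_n K n) x by rewrite (exhaustion_cover K_exhaustion).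
by exists N => // n /= Nn; exact: (exhaustion_homo K_exhaustion) KN.
Qed.

Lemma green_onP n y : K n y ->
  (forall x, x \notin fK n -> green_on n y x = 0) /\
  {in fK n, forall x, H (green_on n y) x = (x == y)%:R}.
Proof.
move=> Kny; rewrite (_ : green_on n y = schrodinger_on_inv b c m [set` fK n] (\1_[set y])).
  2: by rewrite -KE.
have [x|uF Hu] := @schrodinger_on_invP (fK n) (\1_[set y]).
  rewrite inK indicE => xK; rewrite memNset// => xy; move: xK.
  by rewrite xy mem_set.
split=> // x /Hu ->; rewrite indicE; congr (nat_of_bool _)%:R.
by apply/idP/eqP => [/set_mem//|->]; exact: mem_set.
Qed.

Lemma green_on_dom n y : K n y -> dom_F b (green_on n y).
Proof. by move=> /green_onP[/fsupp_dom_F]. Qed.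

Lemma green_on_ge0 n y x : K n y -> 0 <= green_on n y x.
Proof.
move=> Kny; have [gF gH] := green_onP Kny; move: x.
apply: (@comparison (fK n)) => [|x /gF ->//|x /gH ->]; last exact: ler0n.
exact: green_on_dom.
Qed.

(** The difference [f - k * green_on n y] equals [f] off [K n], so comparison applies. With [k = 1]
    this gives monotonicity in [n], with [k = H s x] the lower bound on [s]. *)
Lemma green_on_le n y k f : K n y -> dom_F b f -> (forall x, 0 <= f x) ->
  {in fK n, forall x, k * (x == y)%:R <= H f x} ->
  forall x, k * green_on n y x <= f x.
Proof.
move=> Kny df f0 Hf x; have [gF gH] := green_onP Kny.
have gd := green_on_dom Kny.
rewrite -[f x]mul1r -subr_ge0; move: x.
apply: (@comparison (fK n)) => [|x /gF ->|x xF]; first exact: dom_F_comb.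
  by rewrite mulr0 subr0 mul1r.
by rewrite schrodinger_comb// gH// mul1r subr_ge0 Hf.
Qed.

Lemma green_on_homo n k y x : (n <= k)%N -> K n y ->
  green_on n y x <= green_on k y x.
Proof.
move=> nk Kny; have Kky : K k y by exact: (exhaustion_homo K_exhaustion) Kny.
have [gF gH] := green_onP Kky.
rewrite -[leLHS]mul1r; apply: green_on_le => // [|z|z].
- exact: green_on_dom.
- exact: green_on_ge0.
- rewrite inK => /set_mem zn; rewrite gH ?mul1r// inK; apply/mem_set.
  exact: (exhaustion_homo K_exhaustion) zn.
Qed.

(** Both sides are the energy of the two Green functions against each other: pairing with a pole
    evaluates at it, weighted by [m]. *)
Lemma green_on_sym n x y : K n x -> K n y ->
  m x * green_on n y x = m y * green_on n x y.
Proof.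
move=> Kx Ky; have energyE z w : K n z -> K n w ->
    energy b D (fK n) (green_on n z) (green_on n w) = m z * green_on n w z.
  move=> Kz Kw; have [zF zH] := green_onP Kz; have [wF wH] := green_onP Kw.
  have zFn : z \in fK n by rewrite inK mem_set.
  rewrite /energy (big_fsetD1 z)//= big_seq big1 ?addr0 => [|v].
    by rewrite -(fsupp_schrodingerE _ zF) zH// eqxx mulr1.
  rewrite !inE => /andP[vz vF].
  by rewrite -(fsupp_schrodingerE _ zF) zH// (negPf vz) mulr0 mul0r.
by rewrite -energyE// energy_sym// energyE.
Qed.

Lemma green_on_sumE n x y : K n y -> K n x ->
  D x * green_on n y x - m x * (x == y)%:R = \sum_(z <- fK n) b x z * green_on n y z.
Proof.
move=> Ky Kx; have [gF gH] := green_onP Ky.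
have := gH x; rewrite inK => /(_ (mem_set Kx)) <-.
by rewrite (fsupp_schrodingerE _ gF) /dirichlet; ring.
Qed.

(** Unlike the exact equation, this has a sum over a set independent of [n], so it survives the
    limit; a singleton [F] gives a Harnack-type bound. *)
Lemma fset_le_green_on F n x y : K n y -> K n x ->
  \sum_(z <- F) b x z * green_on n y z <= D x * green_on n y x - m x * (x == y)%:R.
Proof.
move=> Ky Kx; rewrite green_on_sumE//; have [gF _] := green_onP Ky.
rewrite -(rsum_fsupp (F := fK n)) => [|z /gF ->]; last by rewrite mulr0.
apply: fset_le_rsum => [z|]; first by rewrite mulr_ge0// green_on_ge0.
by have /dom_FP := green_on_dom Ky; apply.
Qed.

(** The empty partial sum gives [m x <= D x * green_on n x x], whose second factor is
    nonnegative. *)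
Lemma diag_coef_gt0 n x : K n x -> 0 < D x /\ 0 < green_on n x x.
Proof.
move=> Kx; have := fset_le_green_on fset0 Kx Kx; rewrite big_seq_fset0 eqxx mulr1.
have := m_gt0 x; have := green_on_ge0 x Kx => g0 mx Dg.
have {}Dg : 0 < D x * green_on n x x by lra.
have gx : 0 < green_on n x x.
  by rewrite lt_neqAle g0 andbT eq_sym; apply: contraTneq Dg => ->; rewrite mulr0 ltxx.
by split => //; rewrite -(pmulr_lgt0 _ gx).
Qed.

(** Only those [n] with [y] in [K n] are constrained, since the other values carry no meaning. *)
Definition green_bounded x y := exists M, forall n, K n y -> green_on n y x <= M.

Lemma green_bounded_sym x y : green_bounded x y -> green_bounded y x.
Proof.
move=> [M hM]; exists (m x * M / m y) => n Kx.
(* Symmetry needs both vertices in one [K k]; monotonicity allows passing to such a [k]. *)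
have [k [nk Ky]] : exists k, (n <= k)%N /\ K k y.
  have [N _ KN] := near_exhaustion y.
  by exists (maxn n N); split; [exact: leq_maxl|apply: KN; exact: leq_maxr].
have Kkx : K k x by exact: (exhaustion_homo K_exhaustion) Kx.
apply: le_trans (green_on_homo _ nk Kx) _.
by rewrite ler_pdivlMr// mulrC -green_on_sym// ler_wpM2l ?hM// ltW.
Qed.

Lemma green_bounded_neighbour x z y : 0 < b x z ->
  green_bounded x y -> green_bounded z y.
Proof.
(* The bound is [D x * M / b x z]; absolute values avoid a discussion of signs. *)
move=> bxz [M hM]; exists (`|D x| * `|M| / b x z) => n Ky.
have [k [nk Kx]] : exists k, (n <= k)%N /\ K k x.
  have [N _ KN] := near_exhaustion x.
  by exists (maxn n N); split; [exact: leq_maxl|apply: KN; exact: leq_maxr].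
have Kky : K k y by exact: (exhaustion_homo K_exhaustion) Ky.
apply: le_trans (green_on_homo _ nk Ky) _.
rewrite ler_pdivlMr// mulrC.
have := fset_le_green_on [fset z]%fset Kky Kx; rewrite big_seq_fset1 => /le_trans; apply.
rewrite -normrM; apply: (@le_trans _ _ (D x * green_on k y x)).
  by rewrite gerBl mulr_ge0// ltW.
have [D0 _] := diag_coef_gt0 Kx.
rewrite normrM (gtr0_norm D0) ler_wpM2l ?(ltW D0)//.
exact: le_trans (hM _ Kky) (ler_norm _).
Qed.

(** Boundedness moves along a path in the first argument; symmetry then gives access to the
    second. *)
Lemma green_bounded_all x0 y0 : green_bounded x0 y0 -> forall x y, green_bounded x y.
Proof.
have spread x z y : green_bounded x y -> green_bounded z y.
  have [p] := b_connected x z; elim: p x => [|w p IHp] x /=; first by move=> _ <-.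
  by move=> /andP[bxw pp] pz /(green_bounded_neighbour bxw); exact: IHp.
move=> B x y; apply: (spread y0); apply: green_bounded_sym.
by apply: (spread x0).
Qed.


Lemma green_cvg_ereal_sup N x y : K N y ->
  (green_on n y x)%:E @[n --> \oo] --> ereal_sup (range (fun n => (green_on (n + N) y x)%:E)).
Proof.
move=> KNy; rewrite -(cvg_shiftn N); apply: ereal_nondecreasing_cvgn => i j ij.
rewrite lee_fin; apply: green_on_homo; first by rewrite leq_add2r.
by apply: (exhaustion_homo K_exhaustion) KNy; exact: leq_addl.
Qed.

Lemma green_lty_bounded x y : (green b c m K x y < +oo)%E -> green_bounded x y.
Proof.
have [N _ KN] := near_exhaustion y; have KNy : K N y by apply: KN => /=.
rewrite /green (cvg_lim _ (green_cvg_ereal_sup KNy))//.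
set S := ereal_sup _ => Sy.
have S_ub n : ((green_on (n + N) y x)%:E <= S)%E by apply: ereal_sup_ubound; exists n.
have Sfin : S \is a fin_num.
  rewrite ge0_fin_numE//; apply: le_trans (S_ub 0); rewrite lee_fin.
  by apply: green_on_ge0; rewrite add0n.
exists (fine S) => n Ky; rewrite -lee_fin fineK//; apply: le_trans (S_ub n).
by rewrite lee_fin; apply: green_on_homo Ky; exact: leq_addr.
Qed.

Definition green_fun x y : R := limn (fun n => green_on n y x).

Local Notation g := green_fun.

Hypothesis green_lty : exists x y, (green b c m K x y < +oo)%E.

Lemma green_on_cvg x y : green_on n y x @[n --> \oo] --> g x y.
Proof.
have [x0 [y0 /green_lty_bounded B0]] := green_lty.
have [M hM] := green_bounded_all B0 x y.
have [N _ KN] := near_exhaustion y; have KNy : K N y by apply: KN => /=.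
have KnNy n : K (n + N)%N y by apply: KN => /=; exact: leq_addl.
suff : cvgn (fun n => green_on (n + N)%N y x).
  by move=> /cvg_ex[l ul]; suff : cvgn (fun n => green_on n y x) by [];
    apply/cvg_ex; exists l; rewrite -(cvg_shiftn N).
apply: nondecreasing_is_cvgn => [i j ij|].
  by apply: green_on_homo; rewrite ?leq_add2r.
by exists M => _ [n _ <-]; exact: hM.
Qed.

Lemma greenE x y : green b c m K x y = (g x y)%:E.
Proof. by rewrite /green EFin_lim//; apply: cvgP (@green_on_cvg x y). Qed.

Lemma green_on_le_green n x y : K n y -> green_on n y x <= g x y.
Proof.
move=> Ky; apply: (cvgr_to_ge (@green_on_cvg x y)); exists n => // k /= nk.
exact: green_on_homo.
Qed.

Lemma green_fun_ge0 x y : 0 <= g x y.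
Proof.
apply: (cvgr_to_ge (@green_on_cvg x y)); apply: filterS (near_exhaustion y) => n Ky.
exact: green_on_ge0.
Qed.

Lemma fset_le_green F x y :
  \sum_(z <- F) b x z * g z y <= D x * g x y - m x * (x == y)%:R.
Proof.
have cl : \sum_(z <- F) b x z * green_on n y z @[n --> \oo] -->
    \sum_(z <- F) b x z * g z y.
  by apply: (cvg_big add_continuous) => z _; apply: cvgMl_tmp; exact: green_on_cvg.
have cr : D x * green_on n y x - m x * (x == y)%:R @[n --> \oo] -->
    D x * g x y - m x * (x == y)%:R.
  by apply: cvgB; [apply: cvgMl_tmp; exact: green_on_cvg|exact: cvg_cst].
apply: (ler_cvg_to cl cr); near=> n.
apply: fset_le_green_on; near: n; exact: near_exhaustion.
Unshelve. all: by end_near. Qed.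

Lemma green_dom y : dom_F b (g ^~ y).
Proof.
apply/dom_FP => x; apply: abs_summable_le => F.
under eq_bigr do rewrite ger0_norm ?mulr_ge0 ?green_fun_ge0//.
exact: fset_le_green.
Qed.

(** Monotone convergence by hand: one inequality bounds finite partial sums of the limit, the other
    uses [green_on n y z <= g z y] in the exact equation on [K n]. *)
Lemma schrodinger_green x y : H (g ^~ y) x = (x == y)%:R.
Proof.
apply: (mulfI (lt0r_neq0 (m_gt0 x))); rewrite schrodingerE; last exact: green_dom.
suff -> : rsum (fun z => b x z * g z y) = D x * g x y - m x * (x == y)%:R by ring.
have bg0 z : 0 <= b x z * g z y by rewrite mulr_ge0// green_fun_ge0.
apply/eqP; rewrite eq_le; apply/andP; split.
  by apply: rsum_le_fset => // F; exact: fset_le_green.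
have : (D x * green_on n y x - m x * (x == y)%:R) @[n --> \oo] -->
    D x * g x y - m x * (x == y)%:R.
  by apply: cvgB; [apply: cvgMl_tmp; exact: green_on_cvg|exact: cvg_cst].
move=> /cvgr_to_le; apply; near=> n.
have Kx : K n x by near: n; exact: near_exhaustion.
have Ky : K n y by near: n; exact: near_exhaustion.
rewrite green_on_sumE//; apply: le_trans (fset_le_rsum (fK n) bg0 _).
  by apply: ler_sum => z _; rewrite ler_wpM2l// green_on_le_green.
by have /dom_FP := green_dom y; apply.
Unshelve. all: by end_near. Qed.

Lemma green_superharmonic y : superharmonic b c m (g ^~ y).
Proof. by split=> [|x]; [exact: green_dom|rewrite schrodinger_green]. Qed.

(** A zero would spread to the pole [y], where already [green_on N y y] is positive. *)
Lemma green_gt0 x y : 0 < g x y.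
Proof.
rewrite lt_neqAle green_fun_ge0 andbT eq_sym; apply/eqP => gxy.
have [N _ KN] := near_exhaustion y; have KNy : K N y by apply: KN => /=.
have [_ /lt_le_trans/(_ (green_on_le_green y KNy))] := diag_coef_gt0 KNy.
by rewrite (superharmonic_zero (green_fun_ge0^~ y) (green_superharmonic y) gxy) ltxx.
Qed.

(** * Superharmonic functions against the Green function *)

Context (s : X -> R).
Hypotheses (s_ge0 : forall x, 0 <= s x) (s_super : superharmonic b c m s).

Lemma superharmonic_ge_green x y : H s x * g y x <= s y.
Proof.
have [ds Hs] := s_super.
have cl : H s x * green_on n x y @[n --> \oo] --> H s x * g y x.
  by apply: cvgMl_tmp; exact: green_on_cvg.
apply: (cvgr_to_le cl); apply: filterS (near_exhaustion x) => n Kx; apply: green_on_le => // z _.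
by case: eqP => [->|_]; rewrite ?mulr1 ?mulr0.
Qed.

Lemma superharmonic_green_ratio x y : s x * g y x <= g x x * s y.
Proof.
have [ds Hs] := s_super.
have cl : s x * green_on n x y @[n --> \oo] --> s x * g y x.
  by apply: cvgMl_tmp; exact: green_on_cvg.
have cr : green_on n x x * s y @[n --> \oo] --> g x x * s y.
  by apply: cvgMr_tmp; exact: green_on_cvg.
apply: (ler_cvg_to cl cr); apply: filterS (near_exhaustion x) => n Kx.
have [gF gH] := green_onP Kx; have gd := green_on_dom Kx.
rewrite -subr_ge0; clear cl cr; move: y.
(* The pole [x] is removed from the finite set: the difference vanishes there, whereas its image
   under [H] may be negative. *)
apply: (@comparison (fK n `\ x)%fset) => [|y|y]; first exact: dom_F_comb.
  rewrite !inE negb_and negbK => /orP[/eqP ->|/gF ->].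
    by rewrite mulrC subrr.
  by rewrite mulr0 subr0 mulr_ge0// green_on_ge0.
rewrite !inE => /andP[yx yF]; rewrite schrodinger_comb// gH// (negPf yx) mulr0 subr0.
by rewrite mulr_ge0// green_on_ge0.
Qed.

Lemma superharmonic_green_eq x : H s x * g x x = s x ->
  forall y, s y = H s x * g y x.
Proof.
have [ds Hs] := s_super; have gd := green_dom x.
pose w y := 1 * s y - H s x * g y x => sx y.
suff : w y = 0 by rewrite /w mul1r => /eqP; rewrite subr_eq0 => /eqP.
apply: (@superharmonic_zero _ _ _ x) => [z||]; last by rewrite /w sx mul1r subrr.
  by rewrite /w mul1r subr_ge0 superharmonic_ge_green.
split=> [|z]; first exact: dom_F_comb.
(* [H w] agrees with [H s] away from [x] and vanishes at [x]. *)
rewrite schrodinger_comb// schrodinger_green mul1r subr_ge0.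
by case: eqP => [->|_]; rewrite ?mulr1 ?mulr0.
Qed.

End Green.
End Schrodinger.

Theorem theorem6p1 (R : realType) (X : choiceType)
    (b : X -> X -> R) (c m : X -> R) (K : nat -> set X) (s : X -> R)
    (X_infinite : infinite_set [set: X])
    (b_graph : is_graph b) (b_connected : graph_connected b)
    (m_gt0 : forall x, 0 < m x)
    (K_exhaustion : exhaustion K)
    (H_subcritical : subcritical b c m K)
    (s_ge0 : forall x, 0 <= s x) (s_super : superharmonic b c m s) :
  let H := schrodinger b c m in
  let G := green b c m K in
  (forall x : X,
     ((H s x)%:E <= ereal_inf [set (s y)%:E / G y x | y in [set: X]])%E /\
     (ereal_inf [set (s y)%:E / G y x | y in [set: X]] = (s x)%:E / G x x)%E) /\
  (forall x : X,
     ((H s x)%:E = ereal_inf [set (s y)%:E / G y x | y in [set: X]])%E <->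
     (exists o : X,
        (exists2 a : R, 0 < a & forall y, ((s y)%:E = a%:E * G y o)%E) /\ x = o)
     \/ (forall y, s y = 0)).
Proof.
move=> H G; have [H_nonneg G_lty] := H_subcritical.
pose g := green_fun b c m K.
have GE x y : G x y = (g x y)%:E by exact: greenE.
have g0 x y : 0 < g x y by exact: green_gt0.
have divE x y : ((s y)%:E / G y x = (s y / g y x)%:E)%E.
  by rewrite GE inver gt_eqF.
(* The infimum is attained at [y = x]; the ratio bound shows that no other quotient is smaller. *)
have infE x : (ereal_inf [set (s y)%:E / G y x | y in [set: X]] = (s x / g x x)%:E)%E.
  apply/eqP; rewrite eq_le; apply/andP; split.
    by apply: ereal_inf_lbound; exists x => //; rewrite divE.
  apply: le_ereal_inf_tmp => _ [y _ <-]; rewrite divE lee_fin.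
  rewrite ler_pdivrMr// mulrAC ler_pdivlMr// [leRHS]mulrC.
  exact: superharmonic_green_ratio.
split=> x; rewrite infE.
  split; last by rewrite divE.
  by rewrite lee_fin ler_pdivlMr//; exact: superharmonic_ge_green.
have s_dom := s_super.1.
split=> [[Hsx]|[ [w [[a a0 sE] ->]] |s_zero]].
- have sx : H s x * g x x = s x by rewrite Hsx divfK// gt_eqF.
  have sE y : s y = H s x * g y x by exact: superharmonic_green_eq.
  (* The factor [H s x] decides between the alternatives: [s = 0] if it vanishes, otherwise a
     positive multiple with pole [x]. *)
  have := s_super.2 x; rewrite le_eqVlt => /orP[/eqP Hs0|Hs0].
    by right => y; rewrite sE /H -Hs0 mul0r.
  by left; exists x; split => //; exists (H s x) => // y; rewrite GE -EFinM -sE.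
- have {}sE y : s y = a * g y w by apply: EFin_inj; rewrite EFinM -GE.
  (* In this form [H s w] is computed by [schrodinger_comb]; both sides of the equality are then
     [a]. *)
  have -> : s = (fun y => a * g y w - 0 * g y w).
    by apply/funext => y; rewrite mul0r subr0.
  rewrite /H schrodinger_comb// ?schrodinger_green// ?eqxx; try exact: green_dom.
  by rewrite /= !mul0r !subr0 mulr1 mulfK// gt_eqF.
- have -> : s = (fun y => 0 * s y - 0 * s y).
    by apply/funext => y; rewrite s_zero mul0r subr0.
  by rewrite /H schrodinger_comb// !mul0r subr0 mul0r.
Qed.
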